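(* Let the connected network with $L\ge 2$ agents, the functions $f_i:\mathbb{R}^N\to\mathbb{R}$ ($i=1,\dots,L$), the constants $m_f,M_f$, the matrices $A,B,M_+,M_-$, and the condition numbers $\kappa_f=\frac{M_f}{m_f}$ and $\kappa_{\mathrm G}=\frac{\sigma_{\max}(M_+)}{\tilde\sigma_{\min}(M_-)}$ be as in the context. For $c>0$ and $\mu>1$ define $$\delta(c,\mu)=\min\left\{\frac{(\mu-1)\tilde\sigma_{\min}^2(M_-)}{\mu\,\sigma_{\max}^2(M_+)},\ \frac{m_f}{\frac{c}{4}\sigma_{\max}^2(M_+)+\frac{\mu}{c}M_f^2\tilde\sigma_{\min}^{-2}(M_-)}\right\}.$$ Let $$\mu_{\mathrm t}=\left(1+\frac{\kappa_{\mathrm G}^2}{2\kappa_f^2}-\frac{\kappa_{\mathrm G}}{2\kappa_f}\sqrt{\frac{\kappa_{\mathrm G}^2}{\kappa_f^2}+4}\right)^{-1},\qquad c_{\mathrm t}=\frac{2\mu_{\mathrm t}^{1/2}M_f}{\sigma_{\max}(M_+)\tilde\sigma_{\min}(M_-)}.$$ Then $\mu_{\mathrm t}>1$, and $$\delta(c_{\mathrm t},\mu_{\mathrm t})=\delta_{\mathrm t}:=\frac{1}{2\kappa_f}\sqrt{\frac{1}{\kappa_f^2}+\frac{4}{\kappa_{\mathrm G}^2}}-\frac{1}{2\kappa_f^2},$$ and this is the maximum value of $\delta(c,\mu)$ over all $c>0$ and $\mu>1$. Moreover, for the ADMM iteration described in the context run with $c=c_{\mathrm t}$, one has for all $k\ge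 0$ $$\|x^{k+1}-x^*\|_2^2\le\frac{1}{m_f}\|u^k-u^*\|_G^2.$$
   Context: Network: a connected undirected simple graph with vertex set $\{1,\dots,L\}$ ($L\ge 2$ agents) and $E$ edges. Replacing each edge by its two opposite arcs gives the arc set $\mathcal{A}$ with $|\mathcal{A}|=2E$. Fix an enumeration of $\mathcal{A}$. Variables: $x=[x_1;\dots;x_L]\in\mathbb{R}^{LN}$ with blocks $x_i\in\mathbb{R}^N$; $z\in\mathbb{R}^{2EN}$ is the concatenation of blocks $z_{ij}\in\mathbb{R}^N$, $(i,j)\in\mathcal{A}$; $\beta\in\mathbb{R}^{2EN}$. Semicolons denote vertical concatenation. Objective: $f(x)=\sum_{i=1}^L f_i(x_i)$, where each $f_i$ is differentiable and, for all $\tilde x_a,\tilde x_b\in\mathbb{R}^N$, $\langle \nabla f_i(\tilde x_a)-\nabla f_i(\tilde x_b),\tilde x_a-\tilde x_b\rangle\ge m_{f_i}\|\tilde x_a-\tilde x_b\|_2^2$ with $m_{f_i}>0$ and $\|\nabla f_i(\tilde x_a)-\nabla f_i(\tilde x_b)\|_2\le M_{f_i}\|\tilde x_a-\tilde x_b\|_2$ with $M_{f_i}>0$. Put $m_f=\min_i m_{f_i}$, $M_f=\max_i M_{f_i}$. Matrices: $A_1,A_2\in\mathbb{R}^{2EN\times LN}$ consist of $2E\times L$ blocks of size $N\times N$. If the $q$th arc is $(i,j)$, then the $(q,i)$th block of $A_1$ and the $(q,j)$th block of $A_2$ are the identity $I_N$; all other blocks are zero. $A=[A_1;A_2]$, $B=[-I_{2EN};-I_{2EN}]$,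 $M_+=A_1^T+A_2^T$, $M_-=A_1^T-A_2^T$. $\sigma_{\max}(\cdot)$ denotes the largest singular value and $\tilde\sigma_{\min}(\cdot)$ the smallest nonzero singular value of a matrix. ADMM iteration with parameter $c>0$: a sequence $(x^k,z^k,\beta^k)_{k\ge0}$ such that for all $k\ge0$ $$\nabla f(x^{k+1})+M_-\beta^{k+1}-cM_+(z^k-z^{k+1})=0,\quad \beta^{k+1}-\beta^k-\tfrac c2M_-^Tx^{k+1}=0,\quad \tfrac12M_+^Tx^k-z^k=0,$$ where $\beta^0$ lies in the column space of $M_-^T$. Here $(x^*,z^* )$ is the unique optimal solution of $\min_{x,z} f(x)$ s.t. $Ax+Bz=0$, and $\beta^*$ is the unique vector in the column space of $M_-^T$ with $\nabla f(x^* )+M_-\beta^*=0$. Notation: $u^k=[z^k;\beta^k]$, $u^*=[z^*;\beta^*]$, and $\|u\|_G^2=c\|z\|_2^2+\frac1c\|\beta\|_2^2$ for $u=[z;\beta]$. *)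

(* Defs.v *)
From HB Require Import structures.
From mathcomp Require Import all_boot all_order all_algebra.
From mathcomp Require Import all_classical all_reals all_analysis.
Set Implicit Arguments.
Unset Strict Implicit.
Unset Printing Implicit Defensive.
Import Order.TTheory GRing.Theory Num.Theory.
Import numFieldNormedType.Exports.
Section Graph.

Definition connected_simple_graph L (e : rel 'I_L) : Prop :=
  [/\ symmetric e, irreflexive e & forall i j, connect e i j].

Definition edges L (e : rel 'I_L) : {set {set 'I_L}} :=
  [set [set p.1; p.2] | p : 'I_L * 'I_L & e p.1 p.2].

Definition arc_enumeration L E (e : rel 'I_L)
    (arc : 'I_(2 * E) -> 'I_L * 'I_L) : Prop :=
  injective arc /\ forall i j, e i j <-> exists q, arc q = (i, j).

End Graph.

Local Open Scope classical_set_scope.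
Local Open Scope ring_scope.

(* A stacked vector of n blocks of size N has type 'cV[R]_(\sum_(i < n) N),   *)
(* the shape used by the block matrices of the library: \sum_(i < n) N plays  *)
(* the role of n * N, and block i of v is submxcol v i.                       *)

Section Euclid.
Context {R : realType}.

Definition dot n (u v : 'cV[R]_n) : R := \sum_(i < n) u i 0 * v i 0.

(* The library norm on matrices is the sup norm.                              *)
Definition norm2 n (u : 'cV[R]_n) : R := Num.sqrt (dot u u).

(* Used only at points of differentiability. The topology given by the sup    *)
(* norm is the usual one, so differentiable is the usual notion.              *)
Definition grad n (g : 'cV[R]_n -> R) (x : 'cV[R]_n) : 'cV[R]_n :=
  \col_(i < n) 'D_(delta_mx i 0) g x.

Definition strongly_monotone_grad n (g : 'cV[R]_n -> R) (m : R) : Prop :=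
  forall a b, m * norm2 (a - b) ^+ 2 <= dot (grad g a - grad g b) (a - b).

Definition lipschitz_grad n (g : 'cV[R]_n -> R) (M : R) : Prop :=
  forall a b, norm2 (grad g a - grad g b) <= M * norm2 (a - b).

(* With n > m, A^T A may contribute an extra singular value 0; this changes   *)
(* neither the largest nor the smallest nonzero one.                          *)
Definition singular_values m n (A : 'M[R]_(m, n)) : set R :=
  [set s | 0 <= s /\ eigenvalue (A^T *m A) (s ^+ 2)].

(* The set is finite, so sup and inf are the maximum and the minimum (for     *)
(* A != 0, the case of all the matrices considered).                          *)
Definition sigma_max m n (A : 'M[R]_(m, n)) : R := sup (singular_values A).

Definition sigma_min_nz m n (A : 'M[R]_(m, n)) : R :=
  inf [set s | singular_values A s /\ s != 0].

Definition in_colspace m n (A : 'M[R]_(m, n)) (v : 'cV[R]_m) : Prop :=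
  (v^T <= A^T)%MS.

(* hL only serves to make the index set visibly nonempty, so that the big     *)
(* operators can start from the value at index 0.                             *)
Definition min_const L (hL : (2 <= L)%N) (F : 'I_L -> R) : R :=
  \big[Num.min/F (Ordinal (ltnW hL))]_(i < L) F i.

Definition max_const L (hL : (2 <= L)%N) (F : 'I_L -> R) : R :=
  \big[Num.max/F (Ordinal (ltnW hL))]_(i < L) F i.

End Euclid.

Section Network.
Context {R : realType}.
Variables (L E N : nat) (arc : 'I_(2 * E) -> 'I_L * 'I_L).

Local Notation LN := (\sum_(i < L) N)%N.
Local Notation EN := (\sum_(q < 2 * E) N)%N.

Definition objective (f : 'I_L -> 'cV[R]_N -> R) (x : 'cV[R]_LN) : R :=
  \sum_(i < L) f i (submxcol x i).

Definition A1 : 'M[R]_(EN, LN) :=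
  \mxblock_(q < 2 * E, i < L) (if i == (arc q).1 then 1%:M else 0 : 'M[R]_N).

Definition A2 : 'M[R]_(EN, LN) :=
  \mxblock_(q < 2 * E, j < L) (if j == (arc q).2 then 1%:M else 0 : 'M[R]_N).

Definition Amx : 'M[R]_(EN + EN, LN) := col_mx A1 A2.

Definition Bmx : 'M[R]_(EN + EN, EN) := col_mx (- 1%:M) (- 1%:M).

Definition Mplus : 'M[R]_(LN, EN) := A1^T + A2^T.

Definition Mminus : 'M[R]_(LN, EN) := A1^T - A2^T.

Definition optimal (f : 'cV[R]_LN -> R) (xs : 'cV[R]_LN) (zs : 'cV[R]_EN) :
    Prop :=
  Amx *m xs + Bmx *m zs = 0 /\
  forall x z, Amx *m x + Bmx *m z = 0 -> f xs <= f x.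

Definition admm (f : 'cV[R]_LN -> R) (c : R) (x : nat -> 'cV[R]_LN)
    (z beta : nat -> 'cV[R]_EN) : Prop :=
  in_colspace Mminus^T (beta 0) /\
  forall k : nat,
  [/\ grad f (x k.+1) + Mminus *m beta k.+1
        - c *: (Mplus *m (z k - z k.+1)) = 0,
      beta k.+1 - beta k - (c / 2) *: (Mminus^T *m x k.+1) = 0
    & 2^-1 *: (Mplus^T *m x k) - z k = 0].

Definition normG2 (c : R) (u : 'cV[R]_(EN + EN)) : R :=
  c * norm2 (usubmx u) ^+ 2 + c^-1 * norm2 (dsubmx u) ^+ 2.

End Network.

Arguments A1 {R L E} N arc.
Arguments A2 {R L E} N arc.
Arguments Amx {R L E} N arc.
Arguments Mplus {R L E} N arc.
Arguments Mminus {R L E} N arc.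

(* Main.v *)
Require Import Defs.
From HB Require Import structures.
From mathcomp Require Import all_boot all_order all_algebra.
From mathcomp Require Import all_classical all_reals all_analysis.
From mathcomp Require Import complex ring lra.
Set Implicit Arguments.
Unset Strict Implicit.
Unset Printing Implicit Defensive.
Import Order.TTheory GRing.Theory Num.Theory.
Import numFieldNormedType.Exports.
Local Open Scope classical_set_scope.
Local Open Scope ring_scope.

(* With t = kG / kf and nu = 1 / sqrt mu, the first term of delta is
   (1 - nu^2) / kG^2 and, by AM-GM in c, the second is at most nu / (kf kG),
   with equality at c = 2 sqrt mu Mf / (sp sm). The first decreases and the
   second increases in nu, so the maximum is where 1 - nu^2 = t nu.
   The convergence bound needs no spectral information: strong monotonicity of
   grad f and the optimality conditions give
     mf |x' - x*|^2 <= |u - u*|_G^2 - |u' - u*|_G^2 - |u - u'|_G^2. *)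

(** * Positivity of the extreme nonzero singular values *)

Lemma tr_mulmx_gt0 (R : realFieldType) m n (A : 'M[R]_(m, n)) :
  A != 0 -> 0 < \tr (A^T *m A).
Proof.
have sq_ge0 i : 0 <= \sum_j A j i ^+ 2 by apply: sumr_ge0 => j _; exact: sqr_ge0.
have trE : \tr (A^T *m A) = \sum_i \sum_j A j i ^+ 2.
  by apply: eq_bigr => i _; rewrite mxE; apply: eq_bigr => j _; rewrite mxE expr2.
rewrite trE => A0; rewrite lt_def sumr_ge0 // andbT.
apply: contra A0 => /eqP/psumr_eq0P sum0; apply/eqP/matrixP => j i; rewrite mxE.
have /psumr_eq0P /(_ j isT) /eqP : \sum_j A j i ^+ 2 = 0 by exact: sum0.
by rewrite sqrf_eq0 => H; apply/eqP/H => k _; exact: sqr_ge0.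
Qed.

(** The characteristic polynomial splits over [R[i]], and a real root equals its own real part, so
    the real parts of the complex roots form such a list. *)
Lemma finite_eigenvalues (R : rcfType) n (B : 'M[R]_n) :
  exists s : seq R, forall a, eigenvalue B a -> a \in s.
Proof.
have [r pE] := closed_field_poly_normal (map_poly (real_complex R) (char_poly B)).
exists [seq complex.Re z | z <- r] => a; rewrite eigenvalue_root_char => pa.
have : root (map_poly (real_complex R) (char_poly B)) a%:C%C by rewrite fmorph_root.
rewrite pE map_char_poly (monicP (char_poly_monic _)) scale1r root_prod_XsubC.
by move=> /(map_f (@complex.Re R)).
Qed.

(* If all complex eigenvalues of A^T A were 0, its trace would be 0; a nonzero
   one is |v A^T|^2 / |v|^2 for an eigenvector v, hence a positive real. *)
Lemma gram_eigenvalue_gt0 (R : rcfType) m n (A : 'M[R]_(m, n)) :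
  A != 0 -> exists2 a : R, 0 < a & eigenvalue (A^T *m A) a.
Proof.
move=> A0; pose C := R[i]%C; pose toC := real_complex R.
pose B := A^T *m A; pose p : {poly C} := map_poly toC (char_poly B).
(* This separates [n.-1] from [n], so that the coefficient of ['X^n] at [n.-1], compared below with
   the trace, is 0. *)
have n0 : (0 < n)%N.
  case: n A A0 @B @p => // A; rewrite flatmx0.
  by rewrite (_ : A = 0) ?eqxx //; apply/matrixP => i [].
have [r pE] := closed_field_poly_normal p.
have p1 : lead_coef p = 1 by rewrite /p map_char_poly; exact/monicP/char_poly_monic.
rewrite p1 scale1r in pE.
have [/allP r0 | /allPn[z zr z0]] := boolP (all (pred1 0) r).
  have pX : p = 'X^(size r).
    rewrite pE big_seq (eq_bigr (fun=> 'X)) -?big_seq.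
      by rewrite big_const_seq count_predT iter_mulr_1.
    by move=> z /r0 /eqP ->; rewrite subr0.
  have : p`_n.-1 = - toC (\tr B).
    by rewrite coef_map /= char_poly_trace // rmorphN.
  have -> : p = 'X^n.
    rewrite pX; congr ('X^_); apply: succn_inj.
    by rewrite -(size_polyXn C) -pX size_map_poly size_char_poly.
  rewrite coefXn ltn_eqF ?prednK // => /esym /eqP.
  rewrite oppr_eq0 fmorph_eq0 => /eqP trB0.
  by have := tr_mulmx_gt0 A0; rewrite -/B trB0 ltxx.
have rz : root p z by rewrite pE root_prod_XsubC.
have /eigenvalueP[v vB v0] : eigenvalue (map_mx toC B) z.
  by rewrite eigenvalue_root_char -map_char_poly.
pose w := v *m (map_mx toC A)^T.
have sum_ge0 k (u : 'rV[C]_k) : 0 <= (u *m (map_mx Num.conj u)^T) 0 0.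
  by rewrite mxE; apply: sumr_ge0 => i _; rewrite !mxE mul_conjC_ge0.
have vv : 0 < (v *m (map_mx Num.conj v)^T) 0 0.
  rewrite lt_def sum_ge0 andbT; apply: contra v0; rewrite mxE => /eqP vv0.
  apply/eqP/rowP => i; rewrite mxE; apply/eqP; rewrite -mul_conjC_eq0.
  have vj_ge0 j : true -> 0 <= v 0 j * (map_mx Num.conj v)^T j 0.
    by rewrite !mxE mul_conjC_ge0.
  by have /eqP := psumr_eq0P vj_ge0 vv0 (i := i) isT; rewrite !mxE.
have wwE : w *m (map_mx Num.conj w)^T = z *: (v *m (map_mx Num.conj v)^T).
  have realA : map_mx Num.conj (map_mx toC A) = map_mx toC A.
    by apply/matrixP => i j; rewrite !mxE; exact: conjc_real.
  rewrite /w map_mxM -map_trmx realA trmx_mul trmxK mulmxA -(mulmxA v).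
  by rewrite map_trmx -map_mxM vB -scalemxAl.
have zpos : 0 < z.
  have := sum_ge0 _ w; rewrite wwE mxE pmulr_lge0 // le_eqVlt eq_sym.
  by rewrite (negPf (z0 : z != 0)).
(* In the order of [R[i]], a positive element is real. *)
have zE : z = toC (complex.Re z).
  by rewrite /toC RRe_real // gtr0_real.
exists (complex.Re z).
  by move: zpos; rewrite {1}zE ltcR.
by rewrite eigenvalue_root_char; move: rz; rewrite zE fmorph_root.
Qed.

Lemma singular_value_gt0 (R : realType) m n (A : 'M[R]_(m, n)) :
  A != 0 -> exists2 s, 0 < s & singular_values A s.
Proof.
move=> /gram_eigenvalue_gt0[a a0 Aa]; exists (Num.sqrt a).
  by rewrite sqrtr_gt0.
by split; rewrite ?sqrtr_ge0 // sqr_sqrtr // ltW.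
Qed.

(** A positive singular value lies below the supremum as soon as the set is bounded; without a
    bound, [sup] would take the default value 0. *)
Lemma sigma_max_gt0 (R : realType) m n (A : 'M[R]_(m, n)) :
  A != 0 -> 0 < sigma_max A.
Proof.
move=> /singular_value_gt0[s s0 As]; apply: (lt_le_trans s0).
apply: ub_le_sup => //; have [r rP] := finite_eigenvalues (A^T *m A).
exists (\big[Num.max/1]_(a <- r) a) => t [t0 /rP tr].
(* The list bounds [t ^+ 2]; this bounds [t] too when [t > 1], and the initial value 1 of the
   maximum covers the other case. *)
have [t1 | t1] := leP t 1; first exact: le_trans t1 (bigmax_ge_id _ _ _ _).
apply: le_trans (le_bigmax_seq _ _ xpredT (fun a => a) tr isT).
by rewrite ler_eXnr // ltW.
Qed.

(** Finitely many positive eigenvalues have a positive lower bound [eps], and every nonzero singular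
    value is then at least its square root. Nonemptiness keeps [inf] from its default 0. *)
Lemma sigma_min_nz_gt0 (R : realType) m n (A : 'M[R]_(m, n)) :
  A != 0 -> 0 < sigma_min_nz A.
Proof.
move=> /singular_value_gt0[s s0 As]; have [r rP] := finite_eigenvalues (A^T *m A).
pose eps := \big[Num.min/1]_(a <- r | 0 < a) a.
have eps0 : 0 < eps by apply: lt_bigmin.
apply: (lt_le_trans (y := Num.sqrt eps)); first by rewrite sqrtr_gt0.
apply: lb_le_inf; first by exists s; split=> //; rewrite gt_eqF.
move=> t [[t0 /rP tr] tn0]; rewrite -(ler_sqr) ?nnegrE ?sqrtr_ge0 //.
rewrite sqr_sqrtr ?(ltW eps0) //.
apply: (bigmin_inf_seq _ _ _ _ (fun a => a) tr _ (lexx _)).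
by rewrite exprn_even_gt0.
Qed.

(** * Maximization of [delta] as a problem in real numbers *)

Lemma optimal_parameters (R : rcfType) (m M sp sm : R) :
  0 < m -> 0 < M -> 0 < sp -> 0 < sm ->
  let kf := M / m in
  let kG := sp / sm in
  let delta (c mu : R) :=
    Num.min ((mu - 1) * sm ^+ 2 / (mu * sp ^+ 2))
            (m / (c / 4 * sp ^+ 2 + mu / c * M ^+ 2 * sm ^- 2)) in
  let mut :=
    (1 + kG ^+ 2 / (2 * kf ^+ 2)
       - kG / (2 * kf) * Num.sqrt (kG ^+ 2 / kf ^+ 2 + 4))^-1 in
  let ct := 2 * Num.sqrt mut * M / (sp * sm) in
  let deltat :=
    (2 * kf)^-1 * Num.sqrt ((kf ^+ 2)^-1 + 4 / kG ^+ 2)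
      - (2 * kf ^+ 2)^-1 in
  [/\ 1 < mut, 0 < ct, delta ct mut = deltat
    & forall c mu : R, 0 < c -> 1 < mu -> delta c mu <= deltat].
Proof.
move=> m0 M0 sp0 sm0 kf kG delta mut ct deltat.
have kf0 : 0 < kf by rewrite divr_gt0.
have kG0 : 0 < kG by rewrite divr_gt0.
pose t := kG / kf; have t0 : 0 < t by rewrite divr_gt0.
pose S := Num.sqrt (t ^+ 2 + 4).
have S2 : S ^+ 2 = t ^+ 2 + 4 by rewrite sqr_sqrtr // addr_ge0 ?sqr_ge0.
have S0 : 0 <= S by rewrite sqrtr_ge0.
(* The positive root of [X^2 + t X - 1]. *)
pose nu := (S - t) / 2.
have nu0 : 0 < nu by rewrite /nu; nra.
have nuE : 1 - nu ^+ 2 = nu * t by rewrite /nu; nra.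
have nu1 : nu < 1 by nra.
have mutE : mut = (nu ^+ 2)^-1.
  rewrite /mut -expr_div_n -/t -/S; congr (_^-1).
  have -> : kG ^+ 2 / (2 * kf ^+ 2) = t ^+ 2 / 2 by rewrite /t; field; lra.
  have -> : kG / (2 * kf) = t / 2 by rewrite /t; field; lra.
  by rewrite /nu; nra.
have sqrt_mut : Num.sqrt mut = nu^-1.
  by rewrite mutE -exprVn sqrtr_sqr gtr0_norm // invr_gt0.
have dtE : deltat = nu / (kf * kG).
  (* Pulling [1 / kG] out of the square root leaves [S], because [t = kG / kf]. *)
  have -> : deltat = (2 * kf)^-1 * (S / kG) - (2 * kf ^+ 2)^-1.
    congr (_ * _ - _); rewrite -[kG in RHS]gtr0_norm // -sqrtr_sqr.
    rewrite -sqrtrV ?sqr_ge0 //.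
    rewrite -sqrtrM ?addr_ge0 ?sqr_ge0 //; congr (Num.sqrt _).
    by rewrite /t; field; lra.
  by rewrite /nu /t; field; lra.
have mut1 : 1 < mut by rewrite mutE invf_gt1 ?exprn_gt0 // expr_lt1 ?ltW.
have ct0 : 0 < ct by rewrite /ct sqrt_mut divr_gt0 ?mulr_gt0 ?invr_gt0.
have firstE mu : 1 < mu ->
    (mu - 1) * sm ^+ 2 / (mu * sp ^+ 2) = (1 - mu^-1) / kG ^+ 2.
  by move=> mu1; rewrite /kG; field; lra.
split => //.
  rewrite /delta firstE // mutE invrK nuE.
  have -> : nu * t / kG ^+ 2 = nu / (kf * kG) by rewrite /t; field; lra.
  rewrite dtE /ct sqrt_mut.
  (* At [ct] both summands of the denominator equal [M * kG / (2 * nu)]. *)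
  rewrite (_ : _ + _ = M * kG / nu); last by rewrite /kG; field; lra.
  rewrite (_ : m / _ = nu / (kf * kG)) ?minxx // /kf; field; lra.
move=> c mu c0 mu1; rewrite /delta dtE ge_min.
(* For [mu] at most the optimal [nu ^- 2] the first term of the minimum is small enough; beyond it,
   the second is, whatever [c]. *)
have [le_mu | lt_mu] := leP (nu ^+ 2) mu^-1.
  apply/orP; left; rewrite firstE //.
  rewrite (_ : nu / (kf * kG) = nu * t / kG ^+ 2); last by rewrite /t; field; lra.
  by rewrite ler_wpM2r ?invr_ge0 ?sqr_ge0 // -nuE lerD2l lerN2.
apply/orP; right; set D := _ + _.
pose s := Num.sqrt mu; have s2 : s ^+ 2 = mu by rewrite sqr_sqrtr //; lra.
have s0 : 0 < s by rewrite sqrtr_gt0; lra.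
(* AM-GM on the two summands of D. *)
have amgm : s * M * kG <= D.
  rewrite -subr_ge0 (_ : _ - _ = (c * sp / 2 - s * M / sm) ^+ 2 / c).
    by rewrite divr_ge0 ?sqr_ge0 // ltW.
  by rewrite /D -s2 /kG; field; lra.
have D0 : 0 < D by apply: lt_le_trans amgm; rewrite mulr_gt0 // mulr_gt0.
have nus : 1 <= nu * s.
  have : 1 < (nu * s) ^+ 2 by rewrite exprMn s2 -ltr_pdivrMr ?div1r //; lra.
  by rewrite expr_gt1 ?(mulr_ge0 (ltW nu0) (ltW s0)) //; exact: ltW.
rewrite ler_pdivrMr // (_ : nu / (kf * kG) = nu * m / (M * kG)); last first.
  by rewrite /kf; field; lra.
apply: (@le_trans _ _ (nu * m / (M * kG) * (s * M * kG))).
  rewrite (_ : _ * _ = nu * s * m); first by rewrite ler_peMl // ltW.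
  by field; lra.
by apply: ler_wpM2l => //; apply/ltW/divr_gt0; exact: mulr_gt0.
Qed.

(** * Euclidean inner product of column vectors *)

Section Dot.
Context {R : realType}.

Lemma dotE n (u v : 'cV[R]_n) : dot u v = (u^T *m v) 0 0.
Proof. by rewrite mxE; apply: eq_bigr => i _; rewrite mxE. Qed.

Lemma dotC n (u v : 'cV[R]_n) : dot u v = dot v u.
Proof. by apply: eq_bigr => i _; rewrite mulrC. Qed.

Lemma dotDr n (u v w : 'cV[R]_n) : dot u (v + w) = dot u v + dot u w.
Proof. by rewrite !dotE mulmxDr mxE. Qed.

Lemma dotZr n a (u v : 'cV[R]_n) : dot u (a *: v) = a * dot u v.
Proof. by rewrite !dotE -scalemxAr mxE. Qed.

Lemma dotNr n (u v : 'cV[R]_n) : dot u (- v) = - dot u v.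
Proof. by rewrite -scaleN1r dotZr mulN1r. Qed.

Lemma dot_mulmxr m n (A : 'M[R]_(m, n)) u v :
  dot u (A *m v) = dot (A^T *m u) v.
Proof. by rewrite !dotE trmx_mul trmxK mulmxA. Qed.

Lemma norm2_sqr n (u : 'cV[R]_n) : norm2 u ^+ 2 = dot u u.
Proof. by rewrite sqr_sqrtr // sumr_ge0 // => i _; rewrite -expr2 sqr_ge0. Qed.

Lemma dot_submxcol L (p : 'I_L -> nat) (u v : 'cV[R]_(\sum_i p i)) :
  dot u v = \sum_i dot (submxcol u i) (submxcol v i).
Proof.
rewrite dotE -[u in LHS]submxcolK -[v in LHS]submxcolK tr_mxcol mul_mxrow_mxcol.
by rewrite summxE; apply: eq_bigr => i _; rewrite dotE.
Qed.

(** The two sides differ by the square norm of [a - b]. *)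
Lemma dot_telescope_le n (a b : 'cV[R]_n) :
  2 * dot (a - b) b <= norm2 a ^+ 2 - norm2 b ^+ 2.
Proof.
have := sqr_ge0 (norm2 (a - b)); rewrite !norm2_sqr.
rewrite !(dotC (a - b)) !dotDr !dotNr !(dotC _ a) !(dotC _ b) !dotDr !dotNr.
by rewrite (dotC b a); lra.
Qed.

End Dot.

(** * Gradient and strong monotonicity of the separable objective *)

Section SeparableObjective.
Context {R : realType} (L N : nat) (f : 'I_L -> 'cV[R]_N -> R).
Hypothesis hdiff : forall i a, differentiable (f i) a.
Local Notation LN := (\sum_(i < L) N)%N.

Lemma submxcol_delta (p : 'I_L -> nat) i (j : 'I_(p i)) :
  @submxcol R L p 1 (delta_mx (tagnat.Rank i j) 0) i = delta_mx j 0.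
Proof.
by apply/colP => k; rewrite !mxE -!val_eqE /= tagnat.eq_Rank eqxx.
Qed.

Lemma submxcol_delta0 (p : 'I_L -> nat) i (j : 'I_(p i)) i' :
  i' != i -> @submxcol R L p 1 (delta_mx (tagnat.Rank i j) 0) i' = 0.
Proof.
move=> /negPf ii'; apply/colP => k.
by rewrite !mxE -!val_eqE /= tagnat.eq_Rank ii'.
Qed.

(* The difference quotient of the composite is that of f i, so no chain rule
   is needed. *)
Lemma block_quotientE i (x v : 'cV[R]_LN) :
  (fun h : R => h^-1 *: (((f i \o (fun y => submxcol y i)) \o shift x) (h *: v)
     - (f i \o (fun y => submxcol y i)) x)) =
  (fun h : R => h^-1 *: ((f i \o shift (submxcol x i)) (h *: submxcol v i)
     - f i (submxcol x i))).
Proof.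
apply/funext => h /=; congr (_ *: (f i _ - _)).
by apply/colP => j; rewrite !mxE.
Qed.

(** A coordinate direction of block [i] projects to 0 in every other block, so only the summand
    [f i] contributes to the derivative. *)
Lemma grad_objective (x : 'cV[R]_LN) i :
  submxcol (grad (objective f) x) i = grad (f i) (submxcol x i).
Proof.
apply/colP => j; rewrite !mxE; set k := tagnat.Rank i j.
have -> : objective f = \sum_i' (f i' \o (fun y : 'cV[R]_LN => submxcol y i')).
  by apply/funext => y; rewrite fct_sumE.
rewrite derive_sum; last first.
  by move=> i'; rewrite /derivable block_quotientE; exact: diff_derivable.
have DE i' : 'D_(delta_mx k 0) (f i' \o (fun y : 'cV[R]_LN => submxcol y i')) x
    = 'D_(submxcol (delta_mx k 0) i') (f i') (submxcol x i').
  by rewrite /derive block_quotientE.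
rewrite [LHS](bigD1 i) //= [X in _ + X = _]big1 => [|i' ii']; rewrite DE.
  by rewrite addr0 submxcol_delta.
by rewrite submxcol_delta0 // derive0.
Qed.

Lemma objective_strongly_monotone (m : 'I_L -> R) (m0 : R) :
    (forall i, m0 <= m i) -> (forall i, strongly_monotone_grad (f i) (m i)) ->
  strongly_monotone_grad (objective f) m0.
Proof.
move=> m0_le hm a b; rewrite norm2_sqr !dot_submxcol mulr_sumr.
apply: ler_sum => i _; rewrite !submxcolB !grad_objective.
by apply: le_trans (hm i _ _); rewrite norm2_sqr ler_wpM2r // -norm2_sqr sqr_ge0.
Qed.

End SeparableObjective.

(** * Network matrices and one step of ADMM *)

Section Network.
Context {R : realType} (L E N : nat) (arc : 'I_(2 * E) -> 'I_L * 'I_L).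
Local Notation LN := (\sum_(i < L) N)%N.
Local Notation EN := (\sum_(q < 2 * E) N)%N.

(** The block of the transpose in row [q] at the tail of arc [q] is the identity, or twice it for a
    loop. *)
Lemma Mplus_neq0 (q : 'I_(2 * E)) : (0 < N)%N -> (Mplus N arc : 'M[R]__) != 0.
Proof.
case: N => // n _; apply/eqP => /(congr1 trmx); rewrite trmx0 linearD /= !trmxK.
move=> /(congr1 (fun M => submxblock M q (arc q).1)).
rewrite submxblockD !mxblockK submxblock0 eqxx => /matrixP /(_ 0 0).
rewrite !mxE eqxx; case: eqP => _; rewrite !mxE ?eqxx /= ?mulr1n => ?; lra.
Qed.

(** Same block as for [Mplus]; with distinct endpoints nothing cancels the identity coming from
    [A1]. *)
Lemma Mminus_neq0 (q : 'I_(2 * E)) :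
  (0 < N)%N -> (arc q).1 != (arc q).2 -> (Mminus N arc : 'M[R]__) != 0.
Proof.
case: N => // n _ loop; apply/eqP => /(congr1 trmx); rewrite trmx0 linearB /= !trmxK.
move=> /(congr1 (fun M => submxblock M q (arc q).1)).
rewrite submxblockB !mxblockK submxblock0 eqxx (negPf loop) => /matrixP /(_ 0 0).
rewrite !mxE eqxx /= => ?; lra.
Qed.

(** The constraint says that [A1] and [A2] both send [x] to [z]; add and subtract. *)
Lemma feasibleE (x : 'cV[R]_LN) (z : 'cV[R]_EN) :
  Amx N arc *m x + Bmx E N *m z = 0 ->
  (Mplus N arc)^T *m x = 2 *: z /\ (Mminus N arc)^T *m x = 0.
Proof.
rewrite !mul_col_mx add_col_mx -[0 in RHS]col_mx0 => /eq_col_mx.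
rewrite mulNmx mul1mx => -[/eqP + /eqP].
rewrite !subr_eq0 => /eqP A1x /eqP A2x.
rewrite /Mplus /Mminus linearD linearB /= !trmxK mulmxDl mulmxBl A1x A2x subrr.
by split=> //; rewrite scaler_nat mulr2n.
Qed.

(** Pair the gradient difference with [x k.+1 - xs] and move [Mplus] and [Mminus] to the other side:
    the updates of [z] and [beta] turn the result into [2 c <a - a', a'> + (2 / c) <b - b', b'>],
    and each product telescopes. *)
Lemma admm_descent (g : 'cV[R]_LN -> R) (m c : R) xs zs bs x z beta k :
    0 < c -> strongly_monotone_grad g m -> optimal arc g xs zs ->
    grad g xs + Mminus N arc *m bs = 0 -> admm arc g c x z beta ->
  m * norm2 (x k.+1 - xs) ^+ 2 <= normG2 c (col_mx (z k) (beta k) - col_mx zs bs)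
     - normG2 c (col_mx (z k.+1) (beta k.+1) - col_mx zs bs).
Proof.
move=> c0 hm [/feasibleE[Mpxs Mmxs] _] gxs [_ iter].
(* The relation between [x] and [z] carries no index shift, so it is read at [k.+1]. *)
have [/eqP gE /eqP bE _] := iter k; have [_ _ /eqP zE] := iter k.+1.
apply: le_trans (hm _ _) _.
pose a := z k - zs; pose a' := z k.+1 - zs.
pose b := beta k - bs; pose b' := beta k.+1 - bs.
have DMp : (Mplus N arc)^T *m (x k.+1 - xs) = 2 *: a'.
  move: zE; rewrite /a' subr_eq0 => /eqP <-.
  by rewrite mulmxBr Mpxs scalerBr scalerA mulfV ?scale1r.
have DMm : (Mminus N arc)^T *m (x k.+1 - xs) = (2 / c) *: (b' - b).
  move: bE; rewrite subr_eq0 => /eqP b'E.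
  rewrite mulmxBr Mmxs subr0 /b' /b opprB addrA subrK b'E scalerA.
  by rewrite (_ : 2 / c * (c / 2) = 1) ?scale1r //; field; lra.
(* Subtract the optimality condition at [xs] from the first ADMM equation. *)
have -> : grad g (x k.+1) - grad g xs
    = c *: (Mplus N arc *m (a - a')) - Mminus N arc *m b'.
  have -> : a - a' = z k - z k.+1 by rewrite /a /a' opprB addrA subrK.
  move: gE gxs; rewrite subr_eq0 => /eqP <- /eqP; rewrite addr_eq0 => /eqP ->.
  by rewrite opprK /b' mulmxBr opprB -[RHS]addrA subrKC.
rewrite dotC dotDr dotNr dotZr !dot_mulmxr DMp DMm.
rewrite !(dotC _ (a - a')) !(dotC _ b') !dotZr.
have := dot_telescope_le a a'; have := dot_telescope_le b b'.
rewrite /normG2 !opp_col_mx !add_col_mx !col_mxKu !col_mxKd -/a -/a' -/b -/b'.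
have cV_ge0 : 0 <= c^-1 by rewrite invr_ge0 ltW.
move=> /(ler_wpM2l cV_ge0) + /(ler_wpM2l (ltW c0)).
have -> : dot b' (b' - b) = - dot (b - b') b' by rewrite -opprB dotNr dotC.
lra.
Qed.

End Network.

(** The path from vertex 0 to vertex 1 is nonempty, and its first edge is not a loop by
    irreflexivity. *)
Lemma connected_arc L E (e : rel 'I_L) (arc : 'I_(2 * E) -> 'I_L * 'I_L) :
  (1 < L)%N -> connected_simple_graph e -> arc_enumeration e arc ->
  exists q, (arc q).1 != (arc q).2.
Proof.
move=> L1 [_ e_irr e_conn] [_ arcE].
have /connectP[[|j p] /= ep lastp] := e_conn (Ordinal (ltnW L1)) (Ordinal L1).
  by have /(congr1 val) := lastp.
have /andP[/[dup] eij /arcE[q qE] _] := ep.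
by exists q; rewrite qE /=; apply: contraTneq eij => <-; rewrite e_irr.
Qed.

Theorem theorem2 (R : realType) (L E N : nat) (hL : (2 <= L)%N) (hN : (0 < N)%N)
    (e : rel 'I_L) (he : connected_simple_graph e) (hE : #|edges e| = E)
    (arc : 'I_(2 * E) -> 'I_L * 'I_L) (harc : arc_enumeration e arc)
    (f : 'I_L -> 'cV[R]_N -> R) (mi Mi : 'I_L -> R)
    (hdiff : forall (i : 'I_L) (a : 'cV[R]_N), differentiable (f i) a)
    (hmi : forall i : 'I_L, 0 < mi i) (hMi : forall i : 'I_L, 0 < Mi i)
    (hmono : forall i : 'I_L, strongly_monotone_grad (f i) (mi i))
    (hlip : forall i : 'I_L, lipschitz_grad (f i) (Mi i)) :
  let mf := min_const hL mi in
  let Mf := max_const hL Mi in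
  let sp : R := sigma_max (Mplus N arc) in
  let sm : R := sigma_min_nz (Mminus N arc) in
  let kf := Mf / mf in
  let kG := sp / sm in
  let delta (c mu : R) :=
    Num.min ((mu - 1) * sm ^+ 2 / (mu * sp ^+ 2))
            (mf / (c / 4 * sp ^+ 2 + mu / c * Mf ^+ 2 * sm ^- 2)) in
  let mut :=
    (1 + kG ^+ 2 / (2 * kf ^+ 2)
       - kG / (2 * kf) * Num.sqrt (kG ^+ 2 / kf ^+ 2 + 4))^-1 in
  let ct := 2 * Num.sqrt mut * Mf / (sp * sm) in
  let deltat :=
    (2 * kf)^-1 * Num.sqrt ((kf ^+ 2)^-1 + 4 / kG ^+ 2)
      - (2 * kf ^+ 2)^-1 in
  [/\ 1 < mut,
      0 < ct /\ delta ct mut = deltat,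
      (forall c mu : R, 0 < c -> 1 < mu -> delta c mu <= deltat)
    & forall (xs : 'cV[R]_(\sum_(i < L) N)) (zs bs : 'cV[R]_(\sum_(q < 2 * E) N))
        (x : nat -> 'cV[R]_(\sum_(i < L) N))
        (z beta : nat -> 'cV[R]_(\sum_(q < 2 * E) N)),
      optimal arc (objective f) xs zs ->
      in_colspace (Mminus N arc)^T bs ->
      grad (objective f) xs + Mminus N arc *m bs = 0 ->
      admm arc (objective f) ct x z beta ->
      forall k : nat,
        norm2 (x k.+1 - xs) ^+ 2 <=
        mf^-1 * normG2 ct (col_mx (z k) (beta k) - col_mx zs bs)].
Proof.
move=> mf Mf sp sm kf kG delta mut ct deltat.
have mf0 : 0 < mf by apply: lt_bigmin => // i _; exact: hmi.
have Mf0 : 0 < Mf by apply: lt_le_trans (le_bigmax _ _ (Ordinal (ltnW hL))).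
have [q loopless] := connected_arc hL he harc.
have sp0 : 0 < sp by apply/sigma_max_gt0/(Mplus_neq0 arc q).
have sm0 : 0 < sm by apply/sigma_min_nz_gt0/(Mminus_neq0 (q := q)).
have [mut1 ct0 dE dmax] := optimal_parameters mf0 Mf0 sp0 sm0.
split=> // xs zs bs x z beta opt _ gxs iter k.
have hm : strongly_monotone_grad (objective f) mf.
  by apply: objective_strongly_monotone hmono => // i; exact: bigmin_le.
rewrite mulrC ler_pdivlMr // mulrC.
apply: le_trans (admm_descent _ ct0 hm opt gxs iter) _.
have ctV_ge0 : 0 <= ct^-1 by rewrite invr_ge0 ltW.
(* The subtracted [normG2] at step [k.+1] is nonnegative and is dropped. *)
by rewrite lerBlDr lerDl /normG2 addr_ge0 // mulr_ge0 ?sqr_ge0 ?(ltW ct0).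
Qed.
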